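(* If $\mathcal{F}$ is a finite union-closed family of finite sets such that $\emptyset \in \mathcal{F}$ and $J(\mathcal{F})$ is a non-empty graph, then $\mathcal{F}$ has the density property; that is, there is $U \in J(\mathcal{F})$ such that $\left|\{V \in \mathcal{F} \mid U \subseteq V\}\right| \leq \frac{1}{2}|\mathcal{F}|$.
   Context: A family $\mathcal{F}$ is union-closed iff $U \cup V \in \mathcal{F}$ for all $U, V \in \mathcal{F}$. A generator of $\mathcal{F}$ is a member $U$ such that whenever $\mathcal{G} \subseteq \mathcal{F}$ is non-empty and $\bigcup \mathcal{G} = U$, then $U \in \mathcal{G}$. $J(\mathcal{F})$ is the family of non-empty generators of $\mathcal{F}$ (equivalently, the proper join-irreducibles of the lattice $\mathcal{F}$ ordered by inclusion). A family of sets is called a graph iff each of its members has at most two elements. *)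

(* Defs.v *)
From HB Require Import structures.
From mathcomp Require Import all_boot all_order all_algebra.
From mathcomp Require Import finmap.

Set Implicit Arguments.
Unset Strict Implicit.
Unset Printing Implicit Defensive.

Local Open Scope fset_scope.

Section UnionClosed.
Variable K : choiceType.
Implicit Types (F G : {fset {fset K}}) (U V : {fset K}).

Definition union_closed F : Prop :=
  forall U V, U \in F -> V \in F -> U `|` V \in F.

(* Boolean because the subfamilies of F are finitely many; generatorP below
   gives the form with quantifiers. The empty set is a generator as soon as it
   is a member, which is why G must be non-empty. *)
Definition generator F U : bool :=
  (U \in F) &&
  all (fun G => (G != fset0) ==> (\bigcup_(V <- G) V == U) ==> (U \in G))
      (fpowerset F).

Definition J F : {fset {fset K}} :=
  [fset U in F | generator F U && (U != fset0)].

Definition is_graph F : Prop := forall U, U \in F -> #|` U| <= 2.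

Definition density_property F : Prop :=
  exists2 U, U \in J F &
    (#|` [fset V in F | U `<=` V]|%:R <= 2^-1 * #|` F|%:R :> rat)%R.

Lemma generatorP F U :
  reflect (U \in F /\ forall G, G `<=` F -> G != fset0 ->
             \bigcup_(V <- G) V = U -> U \in G)
          (generator F U).
Proof.
apply: (iffP andP) => -[UF H]; split=> //.
  move=> G GF G0 GU; move/allP: H => /(_ G); rewrite fpowersetE => /(_ GF).
  by rewrite G0 GU eqxx.
apply/allP => G; rewrite fpowersetE => GF.
by apply/implyP => G0; apply/implyP => /eqP; apply: H.
Qed.

Lemma in_J F U : (U \in J F) = generator F U && (U != fset0).
Proof. by rewrite !inE /= /generator; case: (U \in F). Qed.

End UnionClosed.

(* Main.v *)
Require Import Defs.
From mathcomp Require Import all_boot all_order all_algebra.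
From mathcomp Require Import finmap.
From mathcomp Require Import zify ring lra.

Set Implicit Arguments.
Unset Strict Implicit.
Unset Printing Implicit Defensive.

Import Order.TTheory GRing.Theory Num.Theory.

(* Let G be the graph of two-element generators; call x a loop when {x} is a
   generator. Then F consists of the sets whose non-loop points all have a
   neighbour inside the set. If every point is a loop, F is a power set and any
   singleton will do. Otherwise let v be a non-loop of minimal degree d, N its
   neighbourhood and M the set of remaining points. We average over w in N the
   number of members containing the edge vw.

   Write S \ v = A + T with A in N, T in M, and let g(A) count the T all of
   whose points are covered in A + T. Then v + A + T is a member for all these T
   (if A is non-empty), while A + T is one except for b(A) of them, so that
   the average claim reads
     sum_A ([A = 0] + 2|A|/d) g(A) + sum_A b(A) <= sum_A 2 g(A).
   If A + T fails to be a member, some a in A has all its neighbours outside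
   A + T. Let q(A, a) count these T, and let c be the number of non-loops in
   N \ A without neighbour in A. By minimality of d, a has at least
   |A| + c - 1 neighbours in M, whence
     q(A, a) <= 2^(1-|A|-c) g(A)   and   q(A, a) <= (2/3)^(|A|-1) g(A \ a).
   Both hold because T avoids the set D of neighbours of a in M: in the first
   case every subset of D can be added to T; in the second a subset of D may need
   further points outside D to cover it, at most one for each of its points.
   Charging a share of b(A), depending on |A| only, to g(A) by the first bound and
   the rest to the g(A \ a) by the second leaves a numerical inequality. *)

(** * Sums over power sets *)

Lemma sum_powersetU (X : finType) (R : nmodType) (P Q : {set X}) (f : {set X} -> R) :
  [disjoint P & Q] ->
  (\sum_(S in powerset (P :|: Q)) f S =
   \sum_(A in powerset P) \sum_(B in powerset Q) f (A :|: B))%R.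
Proof.
move=> dPQ; rewrite pair_big_dep /=.
rewrite (reindex_onto (fun p : {set X} * {set X} => p.1 :|: p.2)
  (fun S => (S :&: P, S :&: Q))) /=; last first.
  by move=> S; rewrite inE => sS; rewrite -setIUr; apply/setIidPl.
apply: eq_bigl => -[A B] /=; rewrite !inE.
apply/andP/andP => [[_ /eqP[<- <-]]|[sA sB]]; first by rewrite !subsetIr.
split; first exact: setUSS.
have dis (C D C' D' : {set X}) : [disjoint C & D] -> C' \subset C -> D' \subset D ->
   (C' :|: D') :&: C = C'.
  move=> dCD sC sD; rewrite setIUl (setIidPl sC).
  rewrite [D' :&: C](_ : _ = set0) ?setU0 //; apply/eqP; rewrite setI_eq0.
  by rewrite disjoint_sym; apply: disjointWr sD dCD.
rewrite xpair_eqE (dis P Q) // eqxx /= [A :|: B]setUC (dis Q P) //.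
by rewrite disjoint_sym.
Qed.

Lemma sum_powerset1 (X : finType) (R : nmodType) (x : X) (f : {set X} -> R) :
  (\sum_(S in powerset [set x]) f S = f set0 + f [set x])%R.
Proof.
have n0 : [set x] != set0 by apply/set0Pn; exists x; rewrite set11.
rewrite (bigD1 set0) ?inE ?sub0set //= (bigD1 [set x]) ?inE ?subxx ?n0 //=.
rewrite big1 ?addr0 // => S; rewrite inE subset1.
by case/andP=> /andP[/orP[]->].
Qed.

(** Expand the product of the factors [1/2 + 1]: points outside [D] get weight 0 instead of [1/2],
    so only subsets of [D] survive. In [cut_drop] this adds up the contributions of the traces on
    [D]. *)
Lemma sum_half_powerset (X : finType) (D : {set X}) :
  (\sum_(S in powerset D) 2^-1 ^+ #|S| = (3 / 2) ^+ #|D| :> rat)%R.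
Proof.
transitivity (\prod_(x : X) ((if x \in D then 2^-1 else 0) + 1) : rat)%R.
  rewrite bigA_distr [RHS](bigID (mem (powerset D))) /= [X in (_ + X)%R]big1 ?addr0.
    apply: eq_bigr => S; rewrite inE => /subsetP sSD.
    rewrite -big_mkcond /= -prodr_const; apply: eq_bigr => x xS.
    by rewrite (sSD _ xS).
  move=> S; rewrite inE => /subsetPn[x xS xD].
  by rewrite (bigD1 x) //= xS (negPf xD) mul0r.
rewrite (eq_bigr (fun x => if x \in D then 3 / 2 else 1)%R).
  by rewrite -big_mkcond prodr_const.
by move=> x _; case: ifP => _; lra.
Qed.

(** * The numerical inequality behind the charging *)

Section Weights.
Local Open Scope ring_scope.

(* The fraction of b(A), |A| = k, that is charged to g(A) itself. The generic
   threshold is too crude for d < 5. *)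
Definition share (d k : nat) : rat :=
  match d, k with
  | 1, _ => 0
  | 2, 1 => 1 / 2
  | 3, 2 => 1 / 4
  | 4, 3 => 1 / 4
  | 2, _ => (k < 1)%N%:R
  | 3, _ | 4, _ => (k < d.-1)%N%:R
  | _, _ => (k <= uphalf d)%N%:R
  end.

Lemma share_ge5 d k : (4 < d)%N -> share d k = (k <= uphalf d)%N%:R.
Proof. by case: d => [|[|[|[|[|d]]]]]. Qed.

Lemma share_itv d k : 0 <= share d k <= 1.
Proof.
have [d4|d4] := ltnP 4 d; first by rewrite share_ge5 //; case: (_ <= _)%N.
by case: d d4 => [|[|[|[|[|d]]]]] // _; case: k => [|[|[|[|k]]]].
Qed.

(** For [n >= k] the ratio [(n+1) x / n] of consecutive terms is at most [(k+1) x / k <= 1]. *)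
Lemma mul_expr_le (x : rat) k n : 0 <= x -> (0 < k)%N ->
  k.+1%:R * x <= k%:R -> (k <= n)%N -> n%:R * x ^+ n <= k%:R * x ^+ k.
Proof.
move=> x0 k0 xk; elim: n => [|n IH]; first by case: k k0 {xk}.
rewrite leq_eqVlt => /orP[/eqP->//|kn]; apply: le_trans (IH kn).
rewrite exprS mulrA ler_wpM2r ?exprn_ge0 //.
have kn' : k%:R <= n%:R :> rat by rewrite ler_nat.
have k0' : 1 <= k%:R :> rat by rewrite (ler_nat _ 1).
rewrite -[n.+1]addn1 -[k.+1]addn1 !natrD in xk *.
by nra.
Qed.

(** With [b = |A|] and [c = |free A|], the left side is the total coefficient of g(A). The last
    summand collects what the sets [a |: A], [a] in [free A], pass on to [A]; hence the share at
    [b.+1]. *)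
Lemma share_bound d b c : (0 < d)%N -> (b + c <= d)%N ->
  (b == 0%N)%:R + 2 * b%:R / d%:R
   + share d b * Num.min 1 (2 * b%:R / 2 ^+ (b + c))
   + (1 - share d b.+1) * (c%:R * (2 / 3) ^+ b) <= 2.
Proof.
move=> d0 bcd; have [d8|d8] := leqP d 8.
  suff: all (fun d => all (fun b => all (fun c => (b + c <= d)%N ==>
          ((b == 0%N)%:R + 2 * b%:R / d%:R
   + share d b * Num.min 1 (2 * b%:R / 2 ^+ (b + c))
   + (1 - share d b.+1) * (c%:R * (2 / 3) ^+ b) <= 2)) (iota 0 9)) (iota 0 9)) (iota 1 8).
    move=> /allP /(_ d) + ; rewrite mem_iota d0 ltnS d8 => /(_ isT).
    have b8 : (b <= 8)%N by lia.
    have c8 : (c <= 8)%N by lia.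
    move=> /allP /(_ b) + ; rewrite mem_iota ltnS b8 => /(_ isT).
    move=> /allP /(_ c) + ; rewrite mem_iota ltnS c8 => /(_ isT).
    by move=> /implyP; apply.
  by vm_compute.
rewrite !share_ge5 ?(leq_trans _ d8) //.
have dR : 9 <= d%:R :> rat by rewrite (ler_nat _ 9).
have dR0 : 0 < d%:R :> rat by lra.
have bcR : b%:R + c%:R <= d%:R :> rat by rewrite -natrD ler_nat.
have e23 n : 0 <= (2 / 3 : rat) ^+ n by apply: exprn_ge0; lra.
have c0 : 0 <= c%:R :> rat by exact: ler0n.
set m := Num.min _ _.
have m1 : m <= 1 by rewrite /m ge_min lexx.
have m2 : m <= 2 * b%:R / 2 ^+ (b + c) by rewrite /m ge_min lexx orbT.
(* [160 / 243] is the value at [n = 5], from where on the terms do not increase. *)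
have P23 n : (5 <= n)%N -> n%:R * (2 / 3) ^+ n <= 160 / 243 :> rat.
  move=> n5; have := @mul_expr_le (2 / 3) 5 n _ isT _ n5.
  by rewrite !exprS expr0; lra.
(* Both shares are 1 below the threshold and 0 above it; at the threshold they are 1 and 0. *)
have [bt|bt|bt] := ltngtP b (uphalf d).
- rewrite subrr !mul0r addr0 mul1r.
  case: b bt {bcd bcR} @m m1 m2 => [|b] bt m m1 m2.
    by rewrite /= mulr0 mul0r; lra.
  have bd : 2 * b.+1%:R <= d%:R :> rat by rewrite -natrM ler_nat; lia.
  have : 2 * b.+1%:R / d%:R <= 1 :> rat by rewrite ler_pdivrMr ?mul1r.
  by rewrite /=; lra.
- have bd : d%:R <= 2 * b%:R :> rat by rewrite -natrM ler_nat; lia.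
  have b5 : (5 <= b)%N by lia.
  have -> : (b == 0%N) = false by lia.
  rewrite mul0r addr0 add0r subr0 mul1r.
  have bR : 5 <= b%:R :> rat by rewrite (ler_nat _ 5).
  have := P23 _ b5; set e := _ ^+ b => Pe.
  have e0 : 0 <= e := e23 b.
  rewrite -lerBrDr ler_pdivrMr //.
  (* This suffices because [c <= d - b]. *)
  have de : d%:R * e <= 2 by nra.
  nra.
- have b5 : (5 <= b)%N by lia.
  have -> : (b == 0%N) = false by lia.
  have bd : 2 * b%:R <= d%:R + 1 :> rat by rewrite -natrM -(natrD _ _ 1) ler_nat; lia.
  have cb : c%:R <= b%:R :> rat by rewrite ler_nat; lia.
  rewrite add0r subr0 !mul1r.
  have bR : 5 <= b%:R :> rat by rewrite (ler_nat _ 5).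
  have h1 : 2 * b%:R / d%:R <= 10 / 9 :> rat by rewrite (ler_pdivrMr _ _ dR0); lra.
  have h2 : c%:R * (2 / 3) ^+ b <= 160 / 243 :> rat.
    by apply: le_trans (P23 _ b5); apply: ler_wpM2r.
  have h3 : b%:R * 2^-1 ^+ b <= 5 / 32 :> rat.
    have := @mul_expr_le 2^-1 5 b _ isT _ b5.
    by rewrite !exprS expr0; lra.
  move: m2; rewrite exprD invfM -exprVn => m2.
  (* [h2] and the bound [2 b / 2^b] on [m] do not fit together. But for [c = 0] the last summand
     vanishes, and for [c > 0] the factor [2^-c] at least halves the bound on [m]. *)
  case: c c0 {bcd bcR} cb h2 @m m1 m2 => [|c] c0 cb h2 m m1 m2.
    by rewrite expr0 invr1 mulr1 in m2; rewrite mul0r; lra.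
  have : 2 * b%:R * (2^-1 ^+ b * (2 ^+ c.+1)^-1) <= b%:R * 2^-1 ^+ b :> rat.
    rewrite mulrA [2 * _]mulrC -!mulrA ler_wpM2l // mulrCA ler_piMr ?exprn_ge0 //.
    rewrite exprS invfM mulrA divff // mul1r invf_le1 ?exprn_ege1 //.
    by rewrite exprn_gt0.
  lra.
Qed.
End Weights.

(** * Counting sets by their trace on [D] *)

Lemma card_powerset_trace (X : finType) (p : pred {set X}) (M D : {set X}) :
  #|[set T : {set X} | T \subset M & p T]| =
  \sum_(S in powerset D) #|[set T : {set X} | [&& T \subset M, p T & T :&: D == S]]|.
Proof.
rewrite -sum1_card (partition_big (fun T : {set X} => T :&: D) (mem (powerset D))) /=;
  last first.
  by move=> T _; rewrite inE subsetIr.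
apply: eq_bigr => S _; rewrite -sum1_card; apply: eq_bigl => T.
by rewrite !inE andbA.
Qed.

(** As [T] avoids [D], the set [T :|: P :|: S] determines [T] off [P]; recording [T :&: P] as well
    costs the factor [2 ^ #|P|]. *)
Lemma card_powerset_shift (X : finType) (p p' : pred {set X}) (M D P S : {set X}) :
  D \subset M -> P \subset M :\: D -> S \subset D ->
  (forall T : {set X}, T \subset M :\: D -> p T -> p' (T :|: P :|: S)) ->
  #|[set T : {set X} | T \subset (M :\: D) & p T]| <=
  2 ^ #|P| * #|[set T : {set X} | [&& T \subset M, p' T & T :&: D == S]]|.
Proof.
move=> sDM sP sSD pp'; rewrite -card_powerset -cardsX.
pose f (T : {set X}) := (T :&: P, T :|: P :|: S).
have f_inj : {in [set T : {set X} | T \subset (M :\: D) & p T] &, injective f}.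
  move=> T1 T2; rewrite !inE => /andP[sT1 _] /andP[sT2 _] [eI eU].
  have out (T : {set X}) : T \subset M :\: D -> T = (T :|: P :|: S) :\: D :\: P :|: (T :&: P).
    move=> sT; apply/setP => x; rewrite !inE.
    have := subsetP sT x; have := subsetP sSD x; rewrite !inE.
    case: (x \in T) (x \in P) (x \in S) (x \in D) => [] [] [] [] //= h1 h2;
      first [by have := h1 isT | by have := h2 isT].
  by rewrite (out _ sT1) (out _ sT2) eU eI.
rewrite -(card_in_imset f_inj); apply/subset_leq_card/subsetP => _ /imsetP[T + ->].
rewrite !inE /= subsetIr /= => /andP[sT pT]; rewrite pp' //=.
have sMD := subsetDl M D.
rewrite !subUset (subset_trans sT) // (subset_trans sP) // (subset_trans sSD) //=.
apply/eqP/setP => x; rewrite !inE.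
have := subsetP sT x; have := subsetP sP x; have := subsetP sSD x; rewrite !inE.
case: (x \in T) (x \in P) (x \in S) (x \in D) => [] [] [] [] //= h1 h2 h3;
   first [by have := h1 isT | by have := h2 isT | by have := h3 isT].
Qed.

(** * The family of covered sets of a finite graph with loops *)

Section Graph.
Variables (X : finType) (L : pred X) (e : rel X).
Hypotheses (e_sym : symmetric e) (e_irr : irreflexive e).
Implicit Types (A B D S T Q : {set X}).

Definition nbr x : {set X} := [set y | e x y].

(** Two arguments, because parts of a set are tested against the whole; [covers S S] is membership
    in the family. *)
Definition covers Q S := [forall (x | x \in S), L x || (nbr x :&: Q != set0)].

Lemma coversP Q S :
  reflect (forall x, x \in S -> ~~ L x -> exists2 y, e x y & y \in Q) (covers Q S).
Proof.
apply: (iffP forall_inP) => H x xS.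
  move=> nL; have:= H x xS; rewrite (negPf nL) => /set0Pn[y].
  by rewrite !inE => /andP[]; exists y.
case: (boolP (L x)) => //= nL; have [y ey yQ] := H x xS nL.
by apply/set0Pn; exists y; rewrite !inE ey.
Qed.

Lemma coversU Q S T : covers Q (S :|: T) = covers Q S && covers Q T.
Proof.
apply/coversP/andP => [H|[/coversP HS /coversP HT] x]; last by rewrite inE => /orP[/HS|/HT].
by split; apply/coversP => x xS; apply: H; rewrite inE xS ?orbT.
Qed.

Lemma coversS Q Q' S S' : Q \subset Q' -> S' \subset S -> covers Q S -> covers Q' S'.
Proof.
move=> /subsetP sQ /subsetP sS /coversP H; apply/coversP => x /sS xS nL.
by have [y ey /sQ yQ] := H x xS nL; exists y.
Qed.

Notation family := [set S | covers S S].

(** Every set is a member, so deleting [x] injects the members containing [x] into those that avoid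
    it. *)
Lemma count_all_loops x : (forall y, L y) ->
  2 * #|[set S in family | x \in S]| <= #|family|.
Proof.
move=> allL; have cov S : covers S S by apply/coversP => y _; rewrite allL.
rewrite -[leqRHS](cardsID [set S : {set X} | x \in S]) mul2n -addnn leq_add //.
  by apply/subset_leq_card/subsetP => S; rewrite !inE.
have inj : {in [set S in family | x \in S] &, injective (fun S => S :\ x)}.
  by move=> S T; rewrite !inE => /andP[_ xS] /andP[_ xT] eST; rewrite -(setD1K xS) eST setD1K.
rewrite -(card_in_imset inj); apply/subset_leq_card/subsetP => _ /imsetP[S _ ->].
by rewrite !inE eqxx cov.
Qed.

(** * Cuts around a non-loop of minimal degree *)

Variable v : X.
Hypothesis v_min : forall x, ~~ L x -> #|nbr v| <= #|nbr x|.
Let N := nbr v.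
Let M := ~: (v |: N).
Let d := #|N|.

(** In the notation of the overview, g(A), b(A), q(A, a) and c are the sizes of [good A], [bad A],
    [cut A a] and [free A]; [isolated A] holds the points of [A] that only [T] could cover. *)
Definition good A := [set T : {set X} | T \subset M & covers (A :|: T) T].
Definition isolated A := [set a in A | ~~ L a & nbr a :&: A == set0].
Definition free B := [set a in N :\: B | ~~ L a & nbr a :&: B == set0].
Definition bad A := [set T in good A | ~~ covers (A :|: T) A].
Definition cut A a := [set T in good A | [disjoint T & nbr a]].

(** A point of [T] covered by [a] would be a neighbour of [a], and [T] contains none. *)
Lemma cutE A a : a \in isolated A ->
  #|cut A a| = #|[set T : {set X} | T \subset (M :\: nbr a) & covers (A :\ a :|: T) T]|.
Proof.
rewrite inE => /and3P[aA nLa _].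
apply: eq_card => T; rewrite !inE subsetD.
case: (boolP (T \subset M)) => //= TM; rewrite andbC.
case: (boolP [disjoint T & nbr a]) => //= dT.
apply/idP/idP; last first.
  by apply: coversS => //; apply: setSU; apply: subD1set.
move=> /coversP H; apply/coversP => x xT nL; have [y ey] := H x xT nL.
rewrite inE => yAT; exists y => //; rewrite !inE.
case: (eqVneq y a) yAT => [ya|] //= _.
by have /pred0P/(_ x) := dT; rewrite /= !inE xT /= e_sym -ya ey.
Qed.

(** The points of [nbr a :&: M] are covered by [a] itself, so any subset can be added without
    auxiliary points. *)
Lemma cut_self A a : a \in isolated A ->
  #|cut A a| * 2 ^ #|nbr a :&: M| <= #|good A|.
Proof.
move=> aI; rewrite /good (card_powerset_trace _ _ (nbr a :&: M)) (cutE aI).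
rewrite -card_powerset mulnC -sum_nat_const; apply: leq_sum => S; rewrite inE => sS.
have -> : M :\: nbr a = M :\: (nbr a :&: M) by rewrite setDIr setDv setU0.
move: aI; rewrite inE => /and3P[aA nLa _].
rewrite -[leqRHS]mul1n -[X in X * _](_ : 2 ^ #|set0 : {set X}| = 1);
      last by rewrite cards0.
apply: (card_powerset_shift (p' := fun T => covers (A :|: T) T)) => //.
- exact: subsetIr.
- exact: sub0set.
move=> T sT; rewrite setU0 coversU => cT; apply/andP; split.
  apply: coversS cT => //; rewrite setUA; apply: subset_trans (subsetUl _ _).
  by apply: setSU; apply: subD1set.
apply/coversP => x /(subsetP sS); rewrite !inE => /andP[ax _] _.
by exists a; rewrite ?inE ?aA // e_sym.
Qed.

(** Of the at least [d] neighbours of [a], those outside [M] are [v] or lie in [N], but neither in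
    [A], as [a] is isolated, nor in [free A], as [a] is in [A]. *)
Lemma card_nbr_outside A a : A \subset N -> a \in isolated A ->
  #|A| + #|free A| <= (#|nbr a :&: M|).+1.
Proof.
move=> sA; rewrite inE => /and3P[aA nLa /eqP aA0].
have := v_min nLa; rewrite -/N -(cardsID M (nbr a)).
have : nbr a :\: M \subset v |: (N :\: A :\: free A).
  apply/subsetP => y; rewrite !inE negbK => /andP[/orP[->//|vy] ay]; rewrite vy !andbT.
  case: (eqVneq y v) => //= _.
  have yA : y \notin A.
    by apply/negP => yA; move/setP/(_ y): aA0; rewrite !inE ay yA.
  rewrite yA andbT /=; apply/negP => /andP[_] /eqP/setP/(_ a).
  by rewrite !inE e_sym ay aA.
move/subset_leq_card; rewrite cardsU1.
have fN : free A \subset N :\: A by apply/subsetP=> y; rewrite inE => /andP[].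
rewrite (cardsD (N :\: A)) (setIidPr fN) (cardsD N) (setIidPr sA).
have := subset_leq_card sA.
have := subset_leq_card fN; rewrite (cardsD N) (setIidPr sA).
by case: (_ \notin _) => /=; lia.
Qed.

(** In general a trace [S] on [D] is realised by adding [S] and at most [|S|] auxiliary points, so
    it occurs at least [q / 2^|S|] times; summing over [S] gives [(3/2)^|D|]. *)
Lemma cut_drop A a : A \subset N -> a \in isolated A ->
  (#|cut A a|%:R * (3 / 2) ^+ #|A|.-1 <= #|good (A :\ a)|%:R :> rat)%R.
Proof.
move=> sA aI; set D := nbr a :&: M; set B := A :\ a.
have Dd : #|A|.-1 <= #|D|.
  by have := card_nbr_outside sA aI; rewrite -/D; lia.
have sDM : D \subset M by exact: subsetIr.
have cM : M :\: nbr a = M :\: D by rewrite setDIr setDv setU0.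
have aA : a \in A by move: aI; rewrite inE => /and3P[].
have sBN : B \subset N by apply: subset_trans sA; apply: subD1set.
have Bd : #|B| = #|A|.-1 by rewrite (cardsD1 a A) aA.
rewrite /good (card_powerset_trace _ _ D) (cutE aI) cM -/B.
set q := #|_|; pose c S := #|[set T : {set X} |
  [&& T \subset M, covers (B :|: T) T & T :&: D == S]]|.
rewrite -/(\sum_(S in powerset D) c S).
have shift (P S : {set X}) : P \subset M :\: D -> S \subset D ->
  (forall T : {set X}, T \subset M :\: D -> covers (B :|: T) T ->
     covers (B :|: (T :|: (P :|: S))) (P :|: S)) -> q <= 2 ^ #|P| * c S.
  move=> sP sS H; apply: (card_powerset_shift (p' := fun T => covers (B :|: T) T)) => //.
  move=> T sT cT; rewrite -[T :|: P :|: S]setUA coversU H // andbT.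
  by apply: coversS cT => //; apply: setUS; apply: subsetUl.
pose needy i := [&& i \in D, ~~ L i, nbr i :&: B == set0 & nbr i :&: (M :\: D) == set0].
(* If [i] is needy then its at least [|B|] neighbours in [D] together with [i]
   cover one another; otherwise every point of [D] needs at most one point of
   [M :\: D]. *)
case: (pickP needy) => [i /and4P[iD nLi /eqP iB /eqP iMD]|nneedy].
  set Di := nbr i :&: D.
  (* Since [i] is in [M], it is not adjacent to [v]. Being needy, it has all its neighbours in [Di]
     or [N :\: B], and there are at least [d] of them. *)
  have bDi : #|B| <= #|Di|.
    have /subset_leq_card : nbr i \subset Di :|: (N :\: B).
      apply/subsetP => y iy; rewrite inE.
      case: (boolP (y \in Di)) => //= yDi; rewrite inE.
      have -> : y \notin B.
        by apply/negP => yB; move/setP/(_ y): iB; rewrite inE iy yB inE.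
      have : y \notin M.
        apply: contraL isT => yM; move/setP/(_ y): iMD; rewrite !in_setI in_setD iy yM andbT.
        by rewrite in_set0 => /negbFE yD; case/negP: yDi; rewrite inE iy.
      rewrite !inE negbK => /orP[/eqP yv|//].
      have := subsetP sDM _ iD; rewrite !inE negb_or => /andP[_ /negP[]].
      by move: iy; rewrite inE yv e_sym.
    have := v_min nLi; rewrite -/N => le1 le2; have {le1 le2} := leq_trans le1 le2.
    rewrite cardsU (cardsD N) (setIidPr sBN).
    by have := subset_leq_card sBN; lia.
  have iDi : i \notin Di by rewrite !inE e_irr.
  (* [i] covers [Y], and any point of [Y] covers [i]; for empty [Y] nothing would cover [i], so it
     is left out. *)
  pose h (Y : {set X}) := if Y == set0 then set0 else i |: Y.
  have h_inj : {in powerset Di &, injective h}.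
    have hi (Y : {set X}) : Y \subset Di -> h Y :\ i = Y.
      move=> sY; rewrite /h; case: eqP => [->|_]; first by rewrite set0D.
      by rewrite setU1K //; apply: contra iDi; apply: (subsetP sY).
    by move=> Y1 Y2; rewrite !inE => /hi {2}<- /hi {2}<- ->.
  have hc (Y : {set X}) : Y \subset Di -> q <= c (h Y).
    move=> sY; rewrite -[leqRHS]mul1n -[X in X * _](_ : 2 ^ #|set0 : {set X}| = 1);
      last by rewrite cards0.
    have sYD : Y \subset D by apply: subset_trans sY (subsetIr _ _).
    apply: shift; first exact: sub0set.
      by rewrite /h; case: eqP => _; rewrite ?sub0set // subUset sub1set iD.
    move=> T sT _; rewrite set0U; apply/coversP => x.
    rewrite /h; case: eqP => [_|/eqP/set0Pn[y yY]]; first by rewrite inE.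
    have iY z : z \in Y -> e i z by move/(subsetP sY); rewrite !inE => /andP[].
    rewrite !inE => /orP[/eqP->|xY] _.
      by exists y; rewrite ?iY // !inE yY !orbT.
    by exists i; rewrite ?inE ?eqxx ?orbT // e_sym iY.
  (* The traces [h Y] are distinct and each occurs at least [q] times, which gives even the base 2
     instead of [3/2]. *)
  have : q * 2 ^ #|Di| <= \sum_(S in powerset D) c S.
    rewrite -card_powerset mulnC -sum_nat_const.
    apply: (@leq_trans (\sum_(Y in powerset Di) c (h Y))).
      by apply: leq_sum => Y; rewrite inE => /hc.
    rewrite -(big_imset c h_inj) /= [leqRHS](bigID (mem (h @: powerset Di))) /=.
    apply: leq_trans (leq_addr _ _); apply: eq_leq; apply: eq_bigl => S.
    rewrite andb_idl // => /imsetP[Y]; rewrite !inE => sY ->.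
    have sYD : Y \subset D by apply: subset_trans sY (subsetIr _ _).
    by rewrite /h; case: eqP => _; rewrite ?sub0set // subUset sub1set iD.
  rewrite -(ler_nat rat) natrM natrX; apply: le_trans.
  rewrite ler_wpM2l // -Bd (@le_trans _ _ (2 ^+ #|B|)%R) //.
    by rewrite lerXn2r ?nnegrE //; lra.
  by rewrite ler_weXn2l //; lra.
have cS (S : {set X}) : S \subset D -> q <= 2 ^ #|S| * c S.
  (* [f i] is a neighbour of [i] outside [D], itself covered by [i]. The default value never enters
     [P], which uses only points having such a neighbour. *)
  move=> sS; pose f i := odflt i [pick y in nbr i :&: (M :\: D)].
  pose P := f @: [set i in S | nbr i :&: (M :\: D) != set0].
  have fP i : nbr i :&: (M :\: D) != set0 -> f i \in nbr i :&: (M :\: D).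
    by move=> /set0Pn[y yi]; rewrite /f; case: pickP => [//|/(_ y)]; rewrite yi.
  apply: (@leq_trans (2 ^ #|P| * c S)).
    apply: shift => //.
      apply/subsetP => _ /imsetP[i +->].
      by rewrite inE => /andP[_ /fP]; rewrite inE => /andP[].
    move=> T sT _; rewrite coversU; apply/andP; split; apply/coversP.
      move=> _ /imsetP[i +->] _; rewrite inE => /andP[iS /fP].
      rewrite inE => /andP[+ _]; rewrite inE e_sym => ei; exists i => //.
      by rewrite !inE iS !orbT.
    move=> x xS nLx; have := nneedy x; rewrite /needy nLx (subsetP sS _ xS) /=.
    case/nandP => [/set0Pn[y]|xMD].
      by rewrite !inE => /andP[xy yB]; exists y; rewrite ?inE ?yB.
    have := fP _ xMD; rewrite inE => /andP[+ _]; rewrite inE => ?; exists (f x) => //.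
    by rewrite !inE (imset_f f) ?inE ?xS ?orbT.
  rewrite leq_mul2r leq_pexp2l ?orbT //.
  apply: leq_trans (leq_imset_card _ _) _; apply: subset_leq_card.
  by apply/subsetP => i; rewrite inE => /andP[].
apply: (@le_trans _ _ (q%:R * (3 / 2) ^+ #|D|)%R).
  by rewrite ler_wpM2l // ler_weXn2l //; lra.
rewrite -sum_half_powerset mulr_sumr natr_sum; apply: ler_sum => S; rewrite inE => /cS.
rewrite -(ler_nat rat) natrM natrX exprVn ler_pdivrMr ?exprn_gt0 //.
by rewrite mulrC.
Qed.

(** * Two bounds on the bad sets *)

Lemma bad_le_sum_cut A : #|bad A| <= \sum_(a in isolated A) #|cut A a|.
Proof.
have -> : #|bad A| = \sum_(T in good A) (T \in bad A).
  rewrite -sum1_card big_mkcond [RHS]big_mkcond; apply: eq_bigr => T _.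
  by rewrite [T \in bad A]inE; case: (T \in good A) => //=; case: (covers _ _).
have -> : \sum_(a in isolated A) #|cut A a| =
    \sum_(a in isolated A) \sum_T (T \in cut A a).
  apply: eq_bigr => a _; rewrite -sum1_card big_mkcond.
  by apply: eq_bigr => T _; case: (T \in _).
rewrite exchange_big [leqRHS]big_mkcond [leqLHS]big_mkcond /=; apply: leq_sum => T _.
case: ifP => [Tg|_]; last by [].
rewrite inE Tg /=; case: (boolP (covers _ _)) => //= /forall_inPn[a aA].
rewrite negb_or negbK => /andP[nLa /eqP naAT].
have iso : a \in isolated A.
  by rewrite inE aA nLa -subset0 -naAT setIS // subsetUl.
have Tc : T \in cut A a by rewrite inE Tg -setI_eq0 setIC -subset0 -naAT setIS // subsetUr.
by rewrite (bigD1 a) //= Tc.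
Qed.

Local Open Scope ring_scope.

(** The bound 1 comes from [bad A] being part of [good A]; the other is a union bound over at most
    [|A|] isolated points, by [cut_self] and [card_nbr_outside]. *)
Lemma bad_le_self A : A \subset N ->
  #|bad A|%:R <= Num.min 1 (2 * #|A|%:R / 2 ^+ (#|A| + #|free A|)) * #|good A|%:R :> rat.
Proof.
move=> sA; rewrite minr_pMl ?ler0n // mul1r le_min ler_nat; apply/andP; split.
  by apply/subset_leq_card/subsetP => T; rewrite inE => /andP[].
have p2 : 0 < 2 ^+ (#|A| + #|free A|) :> rat by rewrite exprn_gt0.
have cutb a : a \in isolated A ->
    #|cut A a|%:R <= 2 / 2 ^+ (#|A| + #|free A|) * #|good A|%:R :> rat.
  move=> aI; have := cut_self aI.
  have := card_nbr_outside sA aI; rewrite -/N -/M => le1.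
  rewrite -(ler_nat rat) natrM natrX => le2.
  rewrite mulrAC ler_pdivlMr //.
  apply: (@le_trans _ _ (#|cut A a|%:R * 2 ^+ (#|nbr a :&: M|).+1)).
    by rewrite ler_wpM2l // ler_weXn2l.
  by rewrite exprS mulrCA ler_wpM2l.
apply: (@le_trans _ _ (\sum_(a in isolated A) #|cut A a|%:R)).
  by rewrite -natr_sum ler_nat bad_le_sum_cut.
apply: (@le_trans _ _ (\sum_(a in isolated A) (2 / 2 ^+ (#|A| + #|free A|) * #|good A|%:R))).
  exact: ler_sum.
rewrite sumr_const -mulrnAl ler_wpM2r ?ler0n // -mulrnAl.
rewrite ler_wpM2r ?invr_ge0 ?(ltW p2) // -mulr_natr ler_wpM2l // ler_nat.
by apply/subset_leq_card/subsetP => a; rewrite inE => /andP[].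
Qed.

(** Double counting: the pairs [(A, a)] with [a] isolated in [A] correspond to the pairs [(B, a)]
    with [a] in [free B], through [B = A :\ a]. Then [cut_drop] applies to each pair. *)
Lemma sum_cut_le (w : nat -> rat) : (forall k, 0 <= w k) ->
  \sum_(A in powerset N) w #|A| * \sum_(a in isolated A) #|cut A a|%:R <=
  \sum_(B in powerset N) w #|B|.+1 * (#|free B|%:R * (2 / 3) ^+ #|B|) * #|good B|%:R.
Proof.
move=> w0.
have -> : \sum_(A in powerset N) w #|A| * \sum_(a in isolated A) #|cut A a|%:R =
  \sum_(B in powerset N) \sum_(a in free B) w #|B|.+1 * #|cut (a |: B) a|%:R.
  under eq_bigr do rewrite mulr_sumr.
  rewrite !pair_big_dep /=.
  rewrite (reindex_onto (fun p : {set X} * X => (p.2 |: p.1, p.2))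
    (fun p => (p.1 :\ p.2, p.2))) /=.
    apply: eq_big => -[B a] /=; last first.
      move=> /andP[_ /eqP[eB]]; have aB : a \notin B by rewrite -eB !inE eqxx.
      by rewrite cardsU1 aB.
    rewrite xpair_eqE eqxx andbT !inE eqxx /= subUset sub1set !inE.
    apply/idP/idP.
      move=> /andP[/andP[/andP[va ->] /andP[-> /eqP n0]] /eqP eB].
      have -> : a \notin B by rewrite -eB !inE eqxx.
      by rewrite va /= -subset0 -n0 setIS // subsetUr.
    move=> /andP[-> /andP[/andP[aB ->] /andP[-> /eqP n0]]] /=.
    by rewrite setU1K // eqxx andbT setIUr n0 setU0 -subset0; apply/subsetP => x;
      rewrite !inE => /andP[+ /eqP xa]; rewrite xa e_irr.
  by move=> [A a] /= /andP[_]; rewrite inE => /andP[aA _]; rewrite setD1K.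
apply: ler_sum => B; rewrite inE => sB.
rewrite -mulr_sumr -mulrA ler_wpM2l // -mulrA -[#|free B|%:R]sumr_const mulr_suml.
apply: ler_sum => a; rewrite mul1r !inE => /andP[/andP[aB va] /andP[nLa /eqP n0]].
have aI : a \in isolated (a |: B).
  rewrite !inE eqxx nLa /= setIUr n0 setU0 -subset0; apply/subsetP => x.
  by rewrite !inE => /andP[+ /eqP xa]; rewrite xa e_irr.
have sA : a |: B \subset nbr v by rewrite subUset sub1set inE va.
have := cut_drop sA aI.
rewrite setU1K // cardsU1 aB add1n /= => le1.
have e23 : (2 / 3 : rat) = (3 / 2)^-1 by rewrite invf_div.
have p32 : 0 < (3 / 2 : rat) by lra.
by rewrite e23 exprVn [X in _ <= X]mulrC ler_pdivlMr ?exprn_gt0.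
Qed.

(** * Averaging over the edges at [v] *)

Lemma sum_sets_split (f : {set X} -> rat) :
  \sum_S f S =
  \sum_(A in powerset N) \sum_(T in powerset M) (f (A :|: T) + f (v |: (A :|: T))).
Proof.
have vN : [disjoint [set v] & N :|: M].
  rewrite disjoints1 !inE eqxx e_irr; by [].
have NM : [disjoint N & M].
  by rewrite -setI_eq0; apply/eqP/setP => x; rewrite !inE; case: (e v x); rewrite ?orbT ?andbF.
transitivity (\sum_(S in powerset ([set v] :|: (N :|: M))) f S).
  apply: eq_bigl => S; rewrite inE; symmetry; apply/subsetP => x _.
  by rewrite !inE; case: (x == v); case: (e v x).
rewrite sum_powersetU // sum_powerset1 sum_powersetU // sum_powersetU // -big_split /=.
by apply: eq_bigr => A _; rewrite -big_split; apply: eq_bigr => T _; rewrite set0U.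
Qed.

Hypotheses (nLv : ~~ L v) (d_gt0 : (0 < d)%N).

(** [v] covers all of [A] and no point of [T], and is itself covered exactly by the points of
    [A]. *)
Lemma covers_split A T : A \subset N -> T \subset M ->
  covers (v |: (A :|: T)) (v |: (A :|: T)) = (A != set0) && covers (A :|: T) T.
Proof.
move=> sA sT.
have nvT x : x \in T -> (x == v = false) /\ (e v x = false).
  by move/(subsetP sT); rewrite !inE negb_or => /andP[/negPf-> /negPf->].
rewrite !coversU; apply/and3P/andP => [[/coversP Hv _ /coversP HT]|[/set0Pn[y yA] HT]].
  split.
    have [||y vy] := Hv v; rewrite ?inE // => yAT.
    apply/set0Pn; exists y; case/or3P: yAT => [/eqP yv|//|/nvT[_]]; last by rewrite vy.
    by rewrite yv e_irr in vy.
  apply/coversP => x xT nLx; have [y xy] := HT x xT nLx.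
  rewrite !inE => /orP[/eqP yv|yAT]; last by exists y; rewrite ?inE.
  by have [_] := nvT x xT; rewrite e_sym -yv xy.
have vA x : x \in A -> e v x by move/(subsetP sA); rewrite inE.
split.
- apply/coversP => x; rewrite inE => /eqP-> _; exists y; first exact: vA.
  by rewrite !inE yA orbT.
- by apply/coversP => x xA _; exists v; rewrite ?inE ?eqxx // e_sym vA.
- by apply: coversS HT => //; apply: subsetUr.
Qed.

(** The difference counts the members avoiding [v], the last summand those containing [v]. *)
Lemma card_family :
  #|family|%:R = \sum_(A in powerset N)
    ((#|good A|%:R - #|bad A|%:R) + (A != set0)%:R * #|good A|%:R) :> rat.
Proof.
rewrite -sum1_card natr_sum big_mkcond sum_sets_split /=.
apply: eq_bigr => A; rewrite inE => sA; rewrite big_split /=; congr (_ + _).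
  apply/eqP; rewrite eq_sym subr_eq; apply/eqP.
  rewrite -!sum1_card !natr_sum [LHS]big_mkcond [X in _ = _ + X]big_mkcond.
  rewrite [X in _ = X + _]big_mkcond -big_split /=; apply: eq_bigr => T _.
  rewrite !inE coversU; case: (T \subset M) => //=.
  by case: (covers _ A); case: (covers _ T).
rewrite -sum1_card natr_sum [X in _ * X]big_mkcond mulr_sumr [LHS]big_mkcond.
apply: eq_bigr => T _.
rewrite !inE; case: (boolP (T \subset M)) => /= sT; last by rewrite mulr0.
by rewrite covers_split //; case: (A == _); case: (covers _ _);
  rewrite /= ?mulr0 ?mul1r ?mul0r.
Qed.

(** A member [v |: (A :|: T)] is counted once for each [w] in [A]; empty [A] contributes 0 on both
    sides. *)
Lemma sum_card_edges :
  \sum_(w in N) #|[set S in family | (v \in S) && (w \in S)]|%:R =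
  \sum_(A in powerset N) #|A|%:R * #|good A|%:R :> rat.
Proof.
have card_edge w : w \in N -> #|[set S in family | (v \in S) && (w \in S)]|%:R =
    \sum_(A in powerset N) (w \in A)%:R * #|good A|%:R :> rat.
  move=> wN; rewrite -sum1_card natr_sum big_mkcond sum_sets_split /=.
  apply: eq_bigr => A; rewrite inE => sA.
  rewrite -sum1_card natr_sum [X in _ * X]big_mkcond mulr_sumr [LHS]big_mkcond.
  apply: eq_bigr => T _; rewrite !inE.
  case: (boolP (T \subset M)) => /= sT; last by rewrite mulr0.
  have vA : v \in A = false by apply/negP => /(subsetP sA); rewrite inE e_irr.
  have vT : v \in T = false by apply/negP => /(subsetP sT); rewrite !inE eqxx.
  have wv : w == v = false by apply/eqP => wv; move: wN; rewrite wv inE e_irr.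
  have wT : w \in T = false.
    apply/negP => /(subsetP sT); rewrite !inE.
    by move: wN; rewrite inE => ->; rewrite orbT.
  rewrite vA vT wv wT !orbF /= !andbF add0r eqxx /= covers_split //.
  case: (boolP (w \in A)) => [wA|]; last by rewrite andbF mul0r.
  have -> : A != set0 by apply/set0Pn; exists w.
  by case: (covers _ _); rewrite ?mul1r ?mulr1.
rewrite (eq_bigr _ card_edge) exchange_big; apply: eq_bigr => A; rewrite inE => sA /=.
rewrite -mulr_suml; congr (_ * _); rewrite -natr_sum; congr (_%:R).
rewrite -sum1_card big_mkcond [RHS]big_mkcond; apply: eq_bigr => w _.
by case: (boolP (w \in A)) => [/(subsetP sA)->|_] //; case: ifP.
Qed.

Lemma sum_edges_le :
  2 * \sum_(w in N) #|[set S in family | (v \in S) && (w \in S)]|%:R <=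
    d%:R * #|family|%:R :> rat.
Proof.
have dR : 0 < d%:R :> rat by rewrite ltr0n.
rewrite sum_card_edges card_family -ler_pdivrMl //.
set G := fun A => #|good A|%:R : rat; set Z := fun A => #|bad A|%:R : rat.
rewrite -/G -/Z.
pose t k := share d k.
have t01 k : 0 <= t k <= 1 := share_itv d k.
pose mu A : rat := Num.min 1 (2 * #|A|%:R / 2 ^+ (#|A| + #|free A|)).
pose charge A := t #|A| * mu A + (1 - t #|A|.+1) * (#|free A|%:R * (2 / 3) ^+ #|A|).
(* Each [Z A] is split by its share: [bad_le_self] bounds one part, [bad_le_sum_cut] followed by
   [sum_cut_le] the other. *)
have HZ : \sum_(A in powerset N) Z A <=
  \sum_(A in powerset N) charge A * G A.
  apply: (@le_trans _ _ (\sum_(A in powerset N) (t #|A| * mu A * G A +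
     (1 - t #|A|) * \sum_(a in isolated A) #|cut A a|%:R))).
    apply: ler_sum => A; rewrite inE => sA.
    have -> : Z A = t #|A| * Z A + (1 - t #|A|) * Z A by ring.
    have /andP[t0 t1] := t01 #|A|.
    apply: lerD; first by rewrite -mulrA ler_wpM2l //; apply: bad_le_self.
    by rewrite ler_wpM2l ?subr_ge0 // -natr_sum ler_nat bad_le_sum_cut.
  rewrite big_split /= (eq_bigr _ (fun A _ => mulrDl _ _ (G A))) big_split /= lerD2l.
  apply: (@sum_cut_le (fun k => 1 - t k)) => k.
  by have /andP[_] := t01 k; rewrite subr_ge0.
have HG : \sum_(A in powerset N) (2 * #|A|%:R / d%:R + (A == set0)%:R + charge A) * G A
  <= \sum_(A in powerset N) 2 * G A.
  apply: ler_sum => A; rewrite inE => sA; apply: ler_wpM2r; first exact: ler0n.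
  have := @share_bound d #|A| #|free A| d_gt0; rewrite cards_eq0 => H.
  apply: le_trans (H _); first by rewrite [X in X + _ <= _]addrC addrA.
  have : [disjoint A & free A].
    by rewrite -setI_eq0; apply/eqP/setP => x; rewrite !inE; case: (x \in A).
  rewrite -leq_card_setU => /eqP <-; apply/subset_leq_card.
  by rewrite subUset sA; apply/subsetP => x; rewrite !inE => /andP[/andP[]].
rewrite -subr_ge0.
suff -> : \sum_(A in powerset N) (G A - Z A + (A != set0)%:R * G A) =
   \sum_(A in powerset N) 2 * G A - \sum_(A in powerset N) Z A
   - \sum_(A in powerset N) (A == set0)%:R * G A.
  move: HG; under eq_bigr do rewrite mulrDl mulrDl.
  rewrite !big_split /=.
  have -> : d%:R^-1 * (2 * \sum_(A in powerset N) #|A|%:R * G A) =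
    \sum_(A in powerset N) 2 * #|A|%:R / d%:R * G A.
    by rewrite !mulr_sumr; apply: eq_bigr => A _; ring.
  lra.
rewrite -!sumrB; apply: eq_bigr => A _.
by case: (A == set0) => /=; ring.
Qed.

(** Otherwise every one of the [d > 0] summands in [sum_edges_le] would exceed the average. *)
Lemma exists_rare_edge : exists2 w, e v w &
  (2 * #|[set S in family | (v \in S) && (w \in S)]| <= #|family|)%N.
Proof.
have [/exists_inP[w]|/exists_inPn noW] := boolP [exists w in N,
  (2 * #|[set S in family | (v \in S) && (w \in S)]| <= #|family|)%N].
  by rewrite inE => vw le2; exists w.
have := sum_edges_le; rewrite leNgt => /negP[].
have /card_gt0P[w0 w0N] := d_gt0.
rewrite mulr_sumr mulr_natl -sumr_const.
rewrite [ltLHS](bigD1 w0) //= [ltRHS](bigD1 w0) //=.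
apply: ltr_leD; first by have := noW _ w0N; rewrite -natrM ltr_nat ltnNge.
apply: ler_sum => w /andP[wN _]; have := noW _ wN.
by rewrite -ltnNge -natrM ler_nat => /ltnW.
Qed.

End Graph.

Local Open Scope fset_scope.

(** * From union-closed families to graphs *)

Section Transfer.
Variables (K : choiceType) (F : {fset {fset K}}).
Implicit Types (U W : {fset K}).

(** A minimal member containing [x] is a generator: in any subfamily with that union, the set
    containing [x] must be the whole member. *)
Lemma generator_below W x : W \in F -> x \in W ->
  exists2 U, U \in J F & (x \in U) && (U `<=` W).
Proof.
have [n] := ubnP #|` W|; elim: n W => // n IH W Wn WF xW.
have [/hasP[W' W'F /andP[xW' W'W]]|/hasPn noW'] :=
  boolP (has (fun W' => (x \in W') && (W' `<` W)) F).
  have [|U UJ /andP[xU UW']] := IH W' _ W'F xW'.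
    by apply: leq_trans (fproper_ltn_card W'W) _.
  by exists U; rewrite // xU (fsubset_trans UW') // fproper_sub.
exists W; last by rewrite xW fsubset_refl.
rewrite in_J; apply/andP; split; last by apply/fset0Pn; exists x.
apply/generatorP; split=> // G GF _ GW.
move: xW; rewrite -{1}GW => /bigfcupP[W' /andP[W'G _] xW'].
have W'W : W' `<=` W by rewrite -GW; apply: bigfcup_sup.
have := noW' _ (fsubsetP GF _ W'G); rewrite xW' fproperEneq W'W andbT negbK.
by move=> /eqP<-.
Qed.

Hypotheses (F_union_closed : union_closed F) (F_empty : fset0 \in F).

Lemma mem_of_cover W :
  (forall x, x \in W -> exists2 U, U \in F & (x \in U) && (U `<=` W)) -> W \in F.
Proof.
move=> coverW.
have -> : W = \bigcup_(U <- F | U `<=` W) U.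
  apply/fsetP => x; apply/idP/bigfcupP => [/coverW[U UF /andP[xU UW]]|[U /andP[_ UW]]].
    by exists U; rewrite ?UF.
  exact: (fsubsetP UW).
rewrite big_seq_cond; elim/big_rec: _ => // U W' /andP[UF _]; exact: F_union_closed.
Qed.

(** The union of [F] serves as vertex set because its points form a finite type. *)
Let V : {fset K} := \bigcup_(U <- F) U.
Let L (x : V) := [fset val x] \in J F.
Let e (x y : V) := (x != y) && ([fset val x; val y] \in J F).

Let emb (S : {set V}) : {fset K} := [fset val x | x in S].

Lemma in_emb (x : V) (S : {set V}) : (val x \in emb S) = (x \in S).
Proof. by rewrite /emb mem_imfset //; apply: val_inj. Qed.

Lemma emb_inj : injective emb.
Proof. by move=> S T eST; apply/setP => x; rewrite -!in_emb eST. Qed.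

Lemma card_emb (G : {fset {fset K}}) : G `<=` F ->
  #|` G| = #|[set S | emb S \in G]|.
Proof.
move=> GF.
have -> : G = [fset emb S | S in [set S | emb S \in G]].
  apply/fsetP => W; apply/idP/imfsetP => [WG|[S /= + ->]]; last by rewrite inE.
  have eW : W = emb [set x | val x \in W].
    apply/fsetP => x; apply/idP/idP => [xW|/imfsetP[y /= + ->]]; last by rewrite inE.
    have xV : x \in V by apply/bigfcupP; exists W; rewrite ?(fsubsetP GF).
    by rewrite -[x]/(val [` xV]) in_emb inE.
  by exists [set x | val x \in W]; rewrite //= inE -eW.
rewrite card_imfset /=; last exact: emb_inj.
rewrite -cardE; apply: eq_card => S; rewrite !inE mem_imfset //=; last exact: emb_inj.
by rewrite inE.
Qed.

Hypothesis J_graph : is_graph (J F).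

Lemma edge_sym : symmetric e.
Proof. by move=> x y; rewrite /e eq_sym fsetUC. Qed.

Lemma edge_irr : irreflexive e.
Proof. by move=> x; rewrite /e eqxx. Qed.

(** A generator below [W] containing [x] is not the singleton of [x], so, having at most two
    elements, it is an edge at [x]. *)
Lemma nbr_in_member W (x : V) : W \in F -> val x \in W -> ~~ L x ->
  exists2 y, e x y & val y \in W.
Proof.
move=> WF xW nLx; have [U UJ /andP[xU UW]] := generator_below WF xW.
have /fset0Pn[y] : U `\ val x != fset0.
  apply: contra nLx => /eqP U0; rewrite /L.
  suff -> : [fset val x] = U by [].
  by rewrite -(fsetD1K xU) U0 fsetU0.
rewrite !inE => /andP[yx yU].
have yV : y \in V by apply/bigfcupP; exists W; rewrite ?WF ?(fsubsetP UW).
exists [` yV]; last by rewrite /= (fsubsetP UW).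
rewrite /e -val_eqE eq_sym yx /=.
suff -> : [fset val x; y] = U by [].
apply/eqP; rewrite eqEfcard fsubUset !fsub1set xU yU /= cardfs2 eq_sym yx.
exact: J_graph.
Qed.

Lemma J_sub_F U : U \in J F -> U \in F.
Proof. by rewrite in_J => /andP[/generatorP[]]. Qed.

(** A covered set is the union of the loops and edges inside it; conversely [nbr_in_member] finds
    the neighbours. *)
Lemma emb_mem (S : {set V}) : (emb S \in F) = covers L e S S.
Proof.
apply/idP/coversP => [SF x xS nLx|SS].
  have [|y xy] := nbr_in_member SF _ nLx; first by rewrite in_emb.
  by rewrite in_emb; exists y.
apply: mem_of_cover => _ /imfsetP[x /= xS ->].
have [Lx|nLx] := boolP (L x).
  by exists [fset val x]; rewrite ?J_sub_F // fset11 fsub1set in_emb.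
have [y /andP[_ xyJ] yS] := SS x xS nLx.
exists [fset val x; val y]; first exact: J_sub_F.
by rewrite !inE eqxx fsubUset !fsub1set !in_emb xS yS.
Qed.

Lemma density_of_count U (P : pred {set V}) : U \in J F ->
  (forall S, (U `<=` emb S) = P S) ->
  2 * #|[set S in [set S | covers L e S S] | P S]| <= #|[set S | covers L e S S]| ->
  density_property F.
Proof.
move=> UJ UP le2; exists U => //.
have sF : [fset W in F | U `<=` W] `<=` F by apply/fsubsetP => W; rewrite !inE => /andP[].
rewrite (card_emb sF) (card_emb (fsubset_refl F)).
rewrite mulrC ler_pdivlMr // -natrM ler_nat mulnC.
congr (2 * _ <= _): le2; apply: eq_card => S; rewrite !inE /= ?emb_mem ?UP //.
Qed.

Lemma density_of_graph : J F != fset0 -> density_property F.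
Proof.
case/fset0Pn=> U UJ; have UF := J_sub_F UJ.
have memV (x : V) : exists2 W, W \in F & val x \in W.
  by have /bigfcupP[W /andP[WF _] xW] := valP x; exists W.
have [/existsP[v0 nLv0]|/existsPn allL] := boolP [exists x, ~~ L x].
  have [v nLv v_min] := @arg_minnP _ v0 (fun x => ~~ L x) (fun x => #|nbr e x|) nLv0.
  (* [v] lies in some member, which must contain a neighbour of it. *)
  have d_gt0 : 0 < #|nbr e v|.
    have [W WF vW] := memV v; have [w vw _] := nbr_in_member WF vW nLv.
    by apply/card_gt0P; exists w; rewrite inE.
  have [w vw le2] := exists_rare_edge edge_sym edge_irr v_min nLv d_gt0.
  have /andP[_ vwJ] := vw.
  apply: (density_of_count (P := fun S => (v \in S) && (w \in S)) vwJ _ le2) => S.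
  by rewrite fsubUset !fsub1set !in_emb.
have : U != fset0 by move: UJ; rewrite in_J => /andP[].
case/fset0Pn=> x0 x0U; have x0V : x0 \in V by apply/bigfcupP; exists U; rewrite ?UF.
pose x := [` x0V]; have /negPn Lx := allL x.
apply: (density_of_count (P := fun S => x \in S) Lx) => [S|].
  by rewrite fsub1set in_emb.
by apply: count_all_loops => y; apply/negPn.
Qed.

End Transfer.

Theorem theorem4p11p2 (K : choiceType) (F : {fset {fset K}})
    (F_union_closed : union_closed F) (F_empty : fset0 \in F)
    (J_nonempty : J F != fset0) (J_graph : is_graph (J F)) :
  density_property F.
Proof. exact: density_of_graph. Qed.
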